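(* Let $p\ge5$ be a prime and let $E\in\mathbb{F}_p$, $E\neq0$. The Vieta graph of the quartic $(x+y+z+t)^2=Exyzt$ over $\mathbb{F}_p$ has $p^3-1-\sigma(E)p$ vertices in total; it has $4\big((p-3)^2-2\sigma(-E)(p-3)\big)$ vertices of degree $3$, $6\big(1+\sigma(-E)\big)(p-3)$ vertices of degree $2$, $4\big(p^2-3p+3+\sigma(-E)\big)$ vertices of degree $1$, and $6p-5$ vertices of degree $0$.
   Context: $\sigma:\mathbb{F}_p\to\{-1,0,1\}\subset\mathbb{Z}$ denotes the quadratic character: $\sigma(a)=1$ if $a$ is a nonzero square, $\sigma(a)=-1$ if $a$ is a non-square, $\sigma(0)=0$. Let $f(x_1,x_2,x_3,x_4)=(x_1+x_2+x_3+x_4)^2-Ex_1x_2x_3x_4$, which is monic quadratic in each variable. The $i$-th Vieta flip of a solution $x=(x_1,\dots,x_4)\in\mathbb{F}_p^4$ of $f=0$ is the solution obtained by replacing $x_i$ by the other root $x_i'=x_i-(\partial_i f)(x)$ of $f=0$ viewed as a quadratic equation in $x_i$. The Vieta graph is the finite simple graph whose vertices are the solutions of $f=0$ in $\mathbb{F}_p^4$, where two distinct vertices are joined by an edge whenever one is a Vieta flip of the other. *)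

(* Defs.v *)
From mathcomp Require Import all_boot all_order all_algebra.
From mathcomp Require Import mpoly.

Set Implicit Arguments.
Unset Strict Implicit.
Unset Printing Implicit Defensive.

Import GRing.Theory.
Local Open Scope ring_scope.

Definition quadratic_char (F : finFieldType) (a : F) : int :=
  if a == 0 then 0 else if [exists b : F, a == b ^+ 2] then 1 else -1.

(* When f is monic quadratic in the i-th variable, say f = X_i^2 + b X_i + c
   with b and c independent of X_i, then X_i - d_i f = - b - X_i, so this
   replaces the root x_i by the other one. *)
Definition vieta_flip (R : comNzRingType) (n : nat) (f : {mpoly R[n]})
    (i : 'I_n) (x : {ffun 'I_n -> R}) : {ffun 'I_n -> R} :=
  [ffun j => if j == i then x i - (f^`M(i)).@[x] else x j].

Definition solution (F : finFieldType) (n : nat) (f : {mpoly F[n]}) :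
    finType :=
  {x : {ffun 'I_n -> F} | f.@[x] == 0}.

Definition vieta_edge (F : finFieldType) (n : nat) (f : {mpoly F[n]}) :
    rel (solution f) :=
  fun x y => (x != y) &&
    ([exists i, val y == vieta_flip f i (val x)]
     || [exists i, val x == vieta_flip f i (val y)]).

Lemma vieta_edge_irrefl (F : finFieldType) (n : nat) (f : {mpoly F[n]}) :
  irreflexive (@vieta_edge F n f).
Proof. by move=> x; rewrite /vieta_edge eqxx. Qed.

Lemma vieta_edge_sym (F : finFieldType) (n : nat) (f : {mpoly F[n]}) :
  ssrbool.symmetric (@vieta_edge F n f).
Proof. by move=> x y; rewrite /vieta_edge eq_sym orbC. Qed.

Definition degree (T : finType) (e : rel T) (x : T) : nat := #|[set y | e x y]|.

Definition vieta_quartic (R : comNzRingType) (E : R) : {mpoly R[4]} :=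
  (\sum_(i < 4) 'X_i) ^+ 2 - E *: \prod_(i < 4) 'X_i.

Definition num_degree (F : finFieldType) (n : nat) (f : {mpoly F[n]})
    (d : nat) : nat :=
  #|[set x : solution f | degree (@vieta_edge F n f) x == d]|.

(* Main.v *)
Require Import Defs.
From mathcomp Require Import all_boot all_order all_algebra all_fingroup.
From mathcomp Require Import mpoly.
From mathcomp Require Import ring zify.

Import GRing.Theory.
Local Open Scope ring_scope.

(** The flip in position i is an involution that fixes x exactly when
    d_i f(x) = 0, so the degree of x is the number of non-critical positions.
    Let s be the sum of the entries of a solution x. If s <> 0, then d_i f(x) = 0
    is equivalent to 2 x_i = s; if s = 0, some entry vanishes, and d_i f(x) = 0
    means that an entry other than x_i vanishes. Each degree count thus reduces,
    up to the choice of the positions, to counting quadruples that satisfy simple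
    equations, where the solutions of E a^2 = -4 contribute 1 + sigma(-E).

    For the total, fix x, y, t: the number of z is 1 + sigma of a discriminant.
    The substitution t -> 1/t makes that discriminant affine in t up to a square,
    and the remaining sums are of the form sum_x sigma(x^2 + c) = -1. *)

(** * Partial derivatives of the quartic and the action of flips *)

Section Quartic.
Context {R : comNzRingType} (E : R).
Implicit Types x : {ffun 'I_4 -> R}.

Lemma meval_vieta_quartic x :
  (vieta_quartic E).@[x] = (\sum_i x i) ^+ 2 - E * \prod_i x i.
Proof.
rewrite mevalB mevalZ rmorphXn rmorph_sum rmorph_prod /=.
by under eq_bigr do rewrite mevalXU; under [in X in _ - X]eq_bigr do rewrite mevalXU.
Qed.

Lemma meval_mderiv_vieta_quartic i x :
  ((vieta_quartic E)^`M(i)).@[x]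
    = 2 * (\sum_j x j) - E * \prod_(j | j != i) x j.
Proof.
have dX j : ('X_j : {mpoly R[4]})^`M(i) = (j == i)%:R.
  rewrite mderivX mnm1E; case: eqP => [->|_]; last by rewrite scale0r.
  rewrite scale1r (_ : (_ - _)%MM = 0%MM) ?mpolyX0 //.
  by apply/mnmP=> k; rewrite mnmBE subnn mnm0E.
have dsum : (\sum_(j < 4) ('X_j : {mpoly R[4]}))^`M(i) = 1.
  rewrite raddf_sum (bigD1 i) //= dX eqxx big1 ?addr0 // => j /negPf ji.
  by rewrite dX ji.
have dprod : (\prod_(j < 4) ('X_j : {mpoly R[4]}))^`M(i)
    = \prod_(j | j != i) 'X_j.
  rewrite (bigD1 i) //= mderivM dX eqxx mul1r.
  rewrite (_ : _^`M(i) = 0) ?mulr0 ?addr0 //.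
  (* By the Leibniz rule, polynomials killed by the [i]-th derivative are closed under products, so
     the product without ['X_i] is killed. *)
  apply: (big_ind (fun q : {mpoly R[4]} => q^`M(i) = 0)).
  - by rewrite -mpolyC1 mderivC.
  - by move=> p q dp dq; rewrite mderivM dp dq mul0r mulr0 addr0.
  - by move=> j /negPf ji; rewrite dX ji.
rewrite mderivB mderivZ expr2 mderivM dsum dprod mulr1 mul1r -mulr2n.
rewrite mevalB mevalZ mevalMn rmorph_sum rmorph_prod /= -mulr_natl.
by under eq_bigr do rewrite mevalXU; under [in X in _ - X]eq_bigr do rewrite mevalXU.
Qed.

Lemma sum_vieta_flip f i x :
  \sum_j vieta_flip f i x j = \sum_j x j - (f^`M(i)).@[x].
Proof.
rewrite (bigD1 i) //= [in RHS](bigD1 i) //= ffunE eqxx addrAC.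
by congr (_ + _ - _); apply: eq_bigr => j /negPf ji; rewrite ffunE ji.
Qed.

Lemma prod_vieta_flip f i x :
  \prod_(j | j != i) vieta_flip f i x j = \prod_(j | j != i) x j.
Proof. by apply: eq_bigr => j /negPf ji; rewrite ffunE ji. Qed.

(** With [f = X_i^2 + b X_i + c], the flip is [-b - x_i] and the derivative is [2 x_i + b]: the two
    roots lie symmetrically about the zero of the derivative. *)
Lemma mderiv_vieta_flip i x :
  ((vieta_quartic E)^`M(i)).@[vieta_flip (vieta_quartic E) i x]
    = - ((vieta_quartic E)^`M(i)).@[x].
Proof.
rewrite meval_mderiv_vieta_quartic sum_vieta_flip prod_vieta_flip.
by rewrite meval_mderiv_vieta_quartic; ring.
Qed.

(** Since [f] is monic quadratic in the [i]-th variable, lowering [x_i] by [h] changes [f] by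
    [h^2 - h d_i f], which vanishes for [h = d_i f]. *)
Lemma meval_vieta_flip i x :
  (vieta_quartic E).@[vieta_flip (vieta_quartic E) i x]
    = (vieta_quartic E).@[x].
Proof.
rewrite !meval_vieta_quartic sum_vieta_flip.
rewrite [in LHS](bigD1 (op := *%R) i) //= prod_vieta_flip ffunE eqxx.
rewrite [in RHS](bigD1 (op := *%R) i) //=.
by rewrite meval_mderiv_vieta_quartic; ring.
Qed.

Lemma vieta_flipK i : involutive (vieta_flip (vieta_quartic E) i).
Proof.
move=> x; apply/ffunP=> j; rewrite ffunE mderiv_vieta_flip opprK !ffunE eqxx.
by case: eqP => [->|//]; rewrite subrK.
Qed.

End Quartic.

(** * Vertex degrees as numbers of non-critical positions *)

Lemma vieta_flip_eqE {R : comNzRingType} {n} (f : {mpoly R[n]}) i x :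
  (vieta_flip f i x == x) = ((f^`M(i)).@[x] == 0).
Proof.
apply/eqP/eqP => [/ffunP/(_ i)|d0].
  by rewrite ffunE eqxx => /eqP; rewrite -subr_eq0 addrAC subrr sub0r oppr_eq0 => /eqP.
by apply/ffunP=> j; rewrite ffunE d0 subr0; case: eqP => [->|].
Qed.

Lemma card_sub_pred {T : finType} (P Q : pred T) :
  #|[set x : {x | P x} | Q (val x)]| = #|[set x | P x && Q x]|.
Proof.
rewrite -(card_imset _ val_inj); apply: eq_card => x; rewrite inE.
apply/imsetP/andP => [[y]|[Px Qx]].
  by rewrite inE => Qy ->; rewrite (valP y).
by exists (exist (fun x => P x) x Px); rewrite // inE.
Qed.

Definition critical {R : comNzRingType} (E : R) (x : {ffun 'I_4 -> R}) :
    {set 'I_4} :=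
  [set i | ((vieta_quartic E)^`M(i)).@[x] == 0].

(** Flips are involutions, so every neighbour of [x] is itself a flip of [x]; non-critical flips
    move [x], and at different positions they give different neighbours. *)
Lemma degree_vieta {F : finFieldType} (E : F) (x : solution (vieta_quartic E)) :
  degree (@vieta_edge F 4 (vieta_quartic E)) x = (4 - #|critical E (val x)|)%N.
Proof.
have -> : (4 - #|critical E (val x)|)%N = #|~: critical E (val x)|.
  by rewrite [in RHS]cardsCs setCK card_ord.
set f := vieta_quartic E.
have solf i : f.@[vieta_flip f i (val x)] == 0.
  by rewrite meval_vieta_flip (valP x).
pose g i : solution f := exist _ (vieta_flip f i (val x)) (solf i).
have inE' i : (i \in ~: critical E (val x)) = (vieta_flip f i (val x) != val x).
  by rewrite !inE vieta_flip_eqE.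
have edgeE (y : solution f) :
    vieta_edge x y = (x != y) && [exists i, val y == vieta_flip f i (val x)].
  rewrite /vieta_edge; congr (_ && _); rewrite orb_idr //.
  by case/existsP=> i /eqP ->; apply/existsP; exists i; rewrite vieta_flipK.
rewrite /degree -(@card_in_imset _ _ g).
  apply: eq_card => y; rewrite inE edgeE; apply/andP/imsetP.
    case=> nxy /existsP[i /eqP yE]; exists i; last exact: val_inj.
    by rewrite inE' -yE eq_sym; apply: contra nxy => /eqP/val_inj ->.
  case=> i; rewrite inE' => ni ->; split; last by apply/existsP; exists i.
  by apply: contra ni => /eqP {2}->.
(* If the flips at [i != j] agreed, coordinate [i], untouched by the flip at [j], would be
   unchanged, making [i] critical. *)
move=> i j; rewrite !inE' => ni _ /(congr1 val)/ffunP/(_ i) /=.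
rewrite !ffunE eqxx; case: eqP => // _ /eqP.
rewrite -subr_eq0 addrAC subrr sub0r oppr_eq0 => /eqP d0.
by move: ni; rewrite vieta_flip_eqE d0 eqxx.
Qed.

Lemma num_degree_vieta {F : finFieldType} (E : F) (d : nat) : (d <= 4)%N ->
  num_degree (vieta_quartic E) d
    = #|[set x | ((vieta_quartic E).@[fun_of_fin x] == 0)
                  && (#|critical E x| == 4 - d)%N]|.
Proof.
move=> d4; rewrite -card_sub_pred; apply: eq_card => x; rewrite !inE degree_vieta.
(* At most four positions are critical, so the truncated subtractions are exact. *)
by have := max_card (mem (critical E (val x))); rewrite card_ord; move: #|_|; lia.
Qed.

(** * Counting up to permutation of the positions *)

Section Symmetry.
Context {I T : finType}.

Definition ffun_perm (s : {perm I}) (x : {ffun I -> T}) : {ffun I -> T} :=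
  [ffun i => x (s i)].

Lemma ffun_perm_inj s : injective (ffun_perm s).
Proof.
move=> x y /ffunP xy; apply/ffunP=> i.
by have := xy ((s^-1)%g i); rewrite !ffunE permKV.
Qed.

(** List each set followed by its complement; matching entries at equal ranks is a bijection that
    carries [A] onto [B]. *)
Lemma perm_imset_eq (A B : {set I}) :
  #|A| = #|B| -> exists s : {perm I}, s @: A = B.
Proof.
move=> AB; pose t (A : {set I}) := enum A ++ enum (~: A).
have t_in C x : x \in t C.
  by rewrite mem_cat !mem_enum inE orbN.
have t_uniq C : uniq (t C).
  rewrite cat_uniq !enum_uniq andbT; apply/hasPn=> x /=.
  by rewrite !mem_enum inE.
have t_size C : size (t C) = #|I|.
  by rewrite size_cat -!cardE cardsC.
(* The default of [nth] is never reached, by [idx] below. *)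
pose f x := nth x (t B) (index x (t A)).
have idx x : (index x (t A) < size (t B))%N.
  by rewrite t_size -(t_size A) index_mem.
have f_inj : injective f.
  move=> x y; rewrite /f (set_nth_default x y) // => /eqP.
  rewrite nth_uniq // => /eqP /(congr1 (nth x (t A))).
  by rewrite !nth_index.
exists (perm f_inj); apply/eqP; rewrite eqEcard card_imset ?AB ?leqnn ?andbT;
  last exact: perm_inj.
apply/subsetP=> _ /imsetP[x xA ->]; rewrite permE /f.
have xt : (index x (t A) < size (enum B))%N.
  by rewrite index_cat mem_enum xA -cardE -AB cardE index_mem mem_enum.
by rewrite nth_cat xt -mem_enum mem_nth.
Qed.

(** Partition by the value of [A]. A permutation carrying [C] to [B] identifies their fibres, so all
    sets of the size of [B] contribute equally, and the binomial coefficient counts these sets. *)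
Lemma card_equivariant (S : pred {ffun I -> T}) (A : {ffun I -> T} -> {set I})
    (B : {set I}) :
    (forall s x, S (ffun_perm s x) = S x) ->
    (forall s x, A (ffun_perm s x) = s @^-1: A x) ->
  #|[set x | S x && (#|A x| == #|B|)]|
    = ('C(#|I|, #|B|) * #|[set x | S x && (A x == B)]|)%N.
Proof.
move=> Ss As.
have fib (C : {set I}) : #|C| = #|B| ->
    #|[set x | S x && (A x == C)]| = #|[set x | S x && (A x == B)]|.
  move=> CB; have [s sC] := perm_imset_eq _ _ CB.
  rewrite -(card_preimset _ (ffun_perm_inj s)); apply: eq_card => x.
  rewrite !inE Ss As -sC; congr (_ && _).
  rewrite (can2_imset_pre _ (permK s) (permKV s)).
  apply/eqP/eqP => [<-|->]; apply/setP=> i; rewrite !inE ?permKV ?permK //.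
rewrite -card_draws -sum_nat_const -[LHS]sum1_card.
rewrite (partition_big A (fun C : {set I} => C \in [set C : {set I} | #|C| == #|B|])) /=; last first.
  by move=> x; rewrite !inE => /andP[].
apply: eq_bigr => C; rewrite inE => /eqP CB; rewrite -(fib C CB) -[RHS]sum1_card.
apply: eq_bigl => x; rewrite !inE -andbA; case: (A x =P C) => [->|_].
  by rewrite CB eqxx.
by rewrite !andbF.
Qed.

End Symmetry.

(** * Critical positions read off from the entries *)

Section Halves.
Context {F : finFieldType}.
Implicit Types x : {ffun 'I_4 -> F}.

Definition zeros x : {set 'I_4} := [set i | x i == 0].

Definition halves x : {set 'I_4} := [set i | 2 * x i == \sum_j x j].

Lemma sum_ffun_perm s x : \sum_i ffun_perm s x i = \sum_i x i.
Proof.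
rewrite [RHS](reindex_inj (@perm_inj _ s)) /=.
by apply: eq_bigr => i _; rewrite ffunE.
Qed.

Lemma meval_ffun_perm (E : F) s x :
  (vieta_quartic E).@[ffun_perm s x] = (vieta_quartic E).@[x].
Proof.
rewrite !meval_vieta_quartic sum_ffun_perm [\prod_i x i](reindex_inj (@perm_inj _ s)) /=.
by congr (_ - _ * _); apply: eq_bigr => i _; rewrite ffunE.
Qed.

Lemma zeros_ffun_perm s x : zeros (ffun_perm s x) = s @^-1: zeros x.
Proof. by apply/setP=> i; rewrite !inE ffunE. Qed.

Lemma halves_ffun_perm s x : halves (ffun_perm s x) = s @^-1: halves x.
Proof. by apply/setP=> i; rewrite !inE sum_ffun_perm ffunE. Qed.

(** On the surface, [s (s - 2 x_i) = - x_i d_i f]. As [s != 0], a zero of [d_i f] gives [2 x_i = s];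
    conversely [2 x_i = s] forces [x_i != 0], hence [d_i f = 0]. *)
Lemma critical_sum_neq0 (E : F) x :
    (vieta_quartic E).@[x] = 0 -> \sum_i x i != 0 ->
  critical E x = halves x.
Proof.
move=> fx s_neq0; apply/setP=> i; rewrite !inE meval_mderiv_vieta_quartic.
move: fx; rewrite meval_vieta_quartic [\prod_i _](bigD1 i) //=.
move: (\sum_i x i) s_neq0 (\prod_(j | _) x j) => s s_neq0 P fx.
have fE : s * (s - 2 * x i) = - x i * (2 * s - E * P).
  by rewrite -[LHS]subr0 -fx; ring.
apply/eqP/eqP => [d0|xE].
  move/eqP: fE; rewrite d0 mulr0 mulf_eq0 (negPf s_neq0) /= subr_eq0.
  by move/eqP.
move/eqP: fE; rewrite xE subrr mulr0 eq_sym mulf_eq0 oppr_eq0.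
case: (x i =P 0) => [xi0|_ /= /eqP //].
by move: s_neq0; rewrite -xE xi0 mulr0 eqxx.
Qed.

(** Here [d_i f] is [-E] times the product of the other entries. A lone zero entry makes every
    position but its own critical; two zero entries make all four critical. *)
Lemma critical_sum_eq0 (E : F) x : E != 0 -> \sum_i x i = 0 ->
  #|critical E x|
    = if #|zeros x| == 0%N then 0%N else if #|zeros x| == 1%N then 3 else 4.
Proof.
move=> E_neq0 s0.
have critE i : (i \in critical E x) = (zeros x :\ i != set0).
  rewrite inE meval_mderiv_vieta_quartic s0 mulr0 sub0r oppr_eq0.
  rewrite mulf_eq0 (negPf E_neq0) /=; apply/idP/set0Pn.
    by move/prodf_eq0 => [j ji xj]; exists j; rewrite !inE ji.
  by case=> j; rewrite !inE => /andP[ji xj]; apply/prodf_eq0; exists j.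
have [/eqP|z_gt0] := posnP #|zeros x|.
  rewrite cards_eq0 => /eqP z0; apply/eqP.
  rewrite cards_eq0; apply/eqP/setP=> i.
  by rewrite critE z0 set0D eqxx inE.
case: eqP => [/eqP/cards1P[j zj]|z1].
  have -> : critical E x = ~: [set j].
    apply/setP=> i; rewrite critE zj !inE setD_eq0 sub1set inE eq_sym //.
  by rewrite cardsC1 card_ord.
have -> : critical E x = setT; last by rewrite cardsT card_ord.
apply/setP=> i; rewrite critE inE -card_gt0.
by have := cardsD1 i (zeros x); case: (_ \in _); lia.
Qed.

(** A point with [s = 0] is a solution exactly when some entry vanishes. One zero entry then means
    degree 1 and several mean degree 0, so only solutions with [s != 0] have degree 2 or 3. *)
Lemma num_degree_split (E : F) (d : nat) : E != 0 -> (d <= 3)%N ->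
  num_degree (vieta_quartic E) d
    = (#|[set x : {ffun 'I_4 -> F} |
           [&& (vieta_quartic E).@[x] == 0 & \sum_i x i != 0]%R
           && (#|halves x| == 4 - d)%N]|
      + #|[set x : {ffun 'I_4 -> F} | (\sum_i x i == 0)%R
           && (#|zeros x| \in (if d is 0 then [:: 2; 3; 4]
                               else if d == 1 then [:: 1] else [::])%N)]|)%N.
Proof.
move=> E_neq0 d3; rewrite num_degree_vieta; last exact: leqW.
rewrite -[LHS](cardsID [set x : {ffun 'I_4 -> F} | \sum_i x i != 0]).
congr (_ + _)%N; apply: eq_card => x; rewrite !inE.
  rewrite andbAC; apply: andb_id2l => /andP[/eqP fx s0].
  by rewrite critical_sum_neq0.
rewrite negbK; apply: andb_id2l => /eqP s0.
rewrite critical_sum_eq0 // meval_vieta_quartic s0 expr0n sub0r oppr_eq0.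
rewrite mulf_eq0 (negPf E_neq0) /=.
have -> : (\prod_i x i == 0) = (0 < #|zeros x|)%N.
  rewrite card_gt0; apply/prodf_eq0/set0Pn.
    by case=> i _ xi; exists i; rewrite inE.
  by case=> i; rewrite inE => xi; exists i.
have := max_card (mem (zeros x)); rewrite card_ord.
by case: #|_| => [|[|[|[|[|]]]]] //; case: d d3 => [|[|[|[|]]]].
Qed.

End Halves.

(** * Cardinalities as integer sums of indicators *)

Lemma card_as_sum {T : finType} (P : pred T) :
  #|[set x | P x]|%:Z = \sum_x (P x)%:Z.
Proof.
rewrite -sum1_card big_mkcond /= -natz natr_sum; apply: eq_bigr => x _.
by rewrite inE natz; case: (P x).
Qed.

(** Eliminates a summation variable determined by an equation; the counts below collapse by repeated
    use of this. *)
Lemma sum_eq_andz {T : finType} (e : T) (P : pred T) :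
  \sum_x ((x == e) && P x)%:Z = (P e)%:Z.
Proof.
rewrite (bigD1 e) //= eqxx big1 ?addr0 // => x /negPf xe.
by rewrite xe.
Qed.

Lemma sum_eqz {T : finType} (e : T) : \sum_x (x == e)%:Z = 1.
Proof. by rewrite -[RHS](sum_eq_andz e predT); under [RHS]eq_bigr do rewrite andbT. Qed.

(** * Reduction to four-fold sums over the field *)

Section Quadruples.
Context {F : finFieldType}.
Implicit Types a b c d : F.

Definition quad a b c d : {ffun 'I_4 -> F} :=
  [ffun i : 'I_4 => nth 0 [:: a; b; c; d] i].

(** The last coordinate is summed outermost, so that inner coordinates can be solved for in terms of
    the outer ones. *)
Lemma card_quad (P : pred {ffun 'I_4 -> F}) :
  #|[set x | P x]|%:Z = \sum_d \sum_c \sum_b \sum_a (P (quad a b c d))%:Z.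
Proof.
pose q (t : F * F * F * F) := quad t.2 t.1.2 t.1.1.2 t.1.1.1.
pose o k : 'I_4 := inord k.
pose r (x : {ffun 'I_4 -> F}) := (x (o 3), x (o 2), x (o 1), x (o 0))%N.
have qK : cancel q r.
  by case=> [[[d c] b] a]; rewrite /r /q !ffunE !inordK.
have rK : cancel r q.
  move=> x; apply/ffunP=> i; rewrite ffunE -[in RHS](inord_val i) /=.
  by case: i => [[|[|[|[|]]]]].
rewrite card_as_sum (reindex q) /=; last first.
  by exists r => x _; [exact: qK|exact: rK].
pose G d c b a := (P (quad a b c d))%:Z.
rewrite -(pair_bigA _ (fun t => G t.1.1 t.1.2 t.2)) /=.
rewrite -(pair_bigA _ (fun t b => \sum_a G t.1 t.2 b a)) /=.
by rewrite -(pair_bigA _ (fun d c => \sum_b \sum_a G d c b a)).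
Qed.

(** The representative of the [k]-element sets to which [card_equivariant] is applied. *)
Definition initial_set k : {set 'I_4} := [set i : 'I_4 | (i < k)%N].

Lemma card_initial_set k : (k <= 4)%N -> #|initial_set k| = k.
Proof.
move=> k4; rewrite -sum1_card big_mkcond !big_ord_recl big_ord0 !inE /=.
by case: k k4 => [|[|[|[|[|]]]]].
Qed.

Lemma eq_initial_set (A : {set 'I_4}) k :
  (A == initial_set k)
    = [&& (ord0 \in A) == (0 < k), (lift ord0 ord0 \in A) == (1 < k),
          (lift ord0 (lift ord0 ord0) \in A) == (2 < k)
        & (lift ord0 (lift ord0 (lift ord0 ord0)) \in A) == (3 < k)]%N.
Proof.
transitivity (\big[andb/true]_i ((i \in A) == (i \in initial_set k))).
  rewrite big_andE; apply/eqP/forallP => [-> i|AB]; first exact: eqxx.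
  by apply/setP=> i; exact/eqP/AB.
by rewrite !big_ord_recl big_ord0 !inE andbT.
Qed.

Lemma sum_quad a b c d : \sum_i quad a b c d i = a + b + c + d.
Proof. by rewrite !big_ord_recl big_ord0 !ffunE /= addr0 !addrA. Qed.

Lemma meval_quad (E : F) a b c d :
  (vieta_quartic E).@[quad a b c d]
    = (a + b + c + d) ^+ 2 - E * (a * b * c * d).
Proof.
rewrite meval_vieta_quartic sum_quad !big_ord_recl big_ord0 !ffunE /=.
by rewrite mulr1 !mulrA.
Qed.

Lemma zeros_quad a b c d k :
  (zeros (quad a b c d) == initial_set k)
    = [&& (a == 0) == (0 < k)%N, (b == 0) == (1 < k)%N,
          (c == 0) == (2 < k)%N & (d == 0) == (3 < k)%N].
Proof. by rewrite eq_initial_set !inE !ffunE. Qed.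

Lemma halves_quad a b c d k :
  (halves (quad a b c d) == initial_set k)
    = [&& (2 * a == a + b + c + d) == (0 < k)%N,
          (2 * b == a + b + c + d) == (1 < k)%N,
          (2 * c == a + b + c + d) == (2 < k)%N
        & (2 * d == a + b + c + d) == (3 < k)%N].
Proof. by rewrite eq_initial_set !inE sum_quad !ffunE. Qed.

(** By symmetry the zero entries may be taken to be the first [k], at the cost of a binomial factor;
    [card_halves] does the same for [halves]. *)
Lemma card_zeros k : (k <= 4)%N ->
  #|[set x : {ffun 'I_4 -> F} | (\sum_i x i == 0)%R && (#|zeros x| == k)]|%:Z
    = 'C(4, k)%:Z * \sum_(d : F) \sum_(c : F) \sum_(b : F) \sum_(a : F)
        [&& a + b + c + d == 0, (a == 0) == (0 < k)%N, (b == 0) == (1 < k)%N,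
            (c == 0) == (2 < k)%N & (d == 0) == (3 < k)%N]%:Z.
Proof.
move=> k4; rewrite -[in LHS](card_initial_set _ k4).
rewrite (card_equivariant _ zeros); last 2 first.
- by move=> s x; rewrite sum_ffun_perm.
- exact: zeros_ffun_perm.
rewrite card_ord (card_initial_set _ k4) PoszM card_quad; congr (_ * _).
do 4!apply: eq_bigr => ? _.
by rewrite sum_quad zeros_quad.
Qed.

Lemma card_halves (E : F) k : (k <= 4)%N ->
  #|[set x : {ffun 'I_4 -> F} |
       [&& (vieta_quartic E).@[x] == 0 & \sum_i x i != 0]%R
       && (#|halves x| == k)]|%:Z
    = 'C(4, k)%:Z * \sum_(d : F) \sum_(c : F) \sum_(b : F) \sum_(a : F)
        [&& (a + b + c + d) ^+ 2 - E * (a * b * c * d) == 0,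
            a + b + c + d != 0,
            (2 * a == a + b + c + d) == (0 < k)%N,
            (2 * b == a + b + c + d) == (1 < k)%N,
            (2 * c == a + b + c + d) == (2 < k)%N
          & (2 * d == a + b + c + d) == (3 < k)%N]%:Z.
Proof.
move=> k4; rewrite -[in LHS](card_initial_set _ k4).
rewrite (card_equivariant _ halves); last 2 first.
- by move=> s x; rewrite meval_ffun_perm sum_ffun_perm.
- exact: halves_ffun_perm.
rewrite card_ord (card_initial_set _ k4) PoszM card_quad; congr (_ * _).
do 4!apply: eq_bigr => ? _.
by rewrite meval_quad sum_quad halves_quad !andbA.
Qed.

End Quadruples.

(** * Sums of the quadratic character in odd characteristic *)

Section CharacterSums.
Context {F : finFieldType} (two_neq0 : 2 != 0 :> F).
Implicit Types (a b c k u x y : F) (w t : F).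
Local Notation qc := (@quadratic_char F).
Local Notation q := (#|F|%:Z).

Let four_neq0 : 4 != 0 :> F.
Proof. by rewrite (_ : 4 = 2 * 2 :> F) ?mulf_neq0 //; ring. Qed.

Lemma quadratic_char0 : qc 0 = 0.
Proof. by rewrite /quadratic_char eqxx. Qed.

Lemma sum_constz (z : int) : \sum_(x : F) z = q * z.
Proof. by rewrite sumr_const -mulr_natl natz. Qed.

(** Turns the character into a count of square roots: a non-zero square has the roots [c] and [-c],
    distinct because [2 != 0]. *)
Lemma sum_sqr_eq a : \sum_b (b ^+ 2 == a)%:Z = 1 + qc a.
Proof.
rewrite /quadratic_char; have [->|a_neq0] := eqVneq a 0.
  by rewrite addr0 -(sum_eqz (0 : F)); under eq_bigr do rewrite sqrf_eq0.
case: existsP => [[c /eqP ac]|no].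
  have c_neq0 : c != 0 by rewrite -sqrf_eq0 -ac.
  have cNc : c != - c.
    by rewrite -subr_eq0 opprK -mulr2n -mulr_natl mulf_neq0.
  transitivity (\sum_b ((b == c)%:Z + (b == - c)%:Z)); last first.
    by rewrite big_split /= !sum_eqz.
  apply: eq_bigr => b _; rewrite ac eqf_sqr.
  by case: eqP => [->|_] //=; rewrite (negPf cNc).
rewrite subrr big1 // => b _; case: eqP => // ba; case: no.
by exists b; rewrite ba.
Qed.

Lemma quadratic_char_sqrM t a : t != 0 -> qc (t ^+ 2 * a) = qc a.
Proof.
move=> t_neq0; apply: (addrI 1); rewrite -!sum_sqr_eq.
rewrite (reindex_inj (mulfI t_neq0)) /=; apply: eq_bigr => b _.
by rewrite exprMn (inj_eq (mulfI _)) // expf_neq0.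
Qed.

(** Adding 1 to each term counts pairs [(a, b)] with [b^2 = a], and there is one for each [b]. *)
Lemma sum_quadratic_char : \sum_a qc a = 0.
Proof.
apply: (addrI q); rewrite -[X in X + _]mulr1 -sum_constz -big_split /=.
under eq_bigr do rewrite -sum_sqr_eq.
rewrite exchange_big /= addr0 -[RHS]mulr1 -sum_constz.
by apply: eq_bigr => b _; under eq_bigr do rewrite eq_sym; rewrite sum_eqz.
Qed.

Lemma sum_quadratic_char_affine a b : b != 0 -> \sum_w qc (a + b * w) = 0.
Proof.
move=> b_neq0; rewrite -[RHS]sum_quadratic_char.
have inj : injective (fun w => a + b * w).
  by move=> v w /addrI; apply: mulfI.
by rewrite [RHS](reindex_inj inj).
Qed.

(** Adding 1 to each term counts the points of the hyperbola [b^2 = x^2 + c]. With [b = x + u] it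
    reads [u (2 x + u) = c], where each [u != 0] determines [x]: there are [q - 1] points. *)
Lemma sum_quadratic_char_sqrD c : c != 0 -> \sum_x qc (x ^+ 2 + c) = - 1.
Proof.
move=> c_neq0; apply: (addrI q); rewrite -[X in X + _]mulr1 -sum_constz -big_split /=.
transitivity (\sum_x \sum_u (u * (2 * x + u) == c)%:Z).
  apply: eq_bigr => x _; rewrite -sum_sqr_eq (reindex_inj (addrI x)) /=.
  apply: eq_bigr => u _; congr (nat_of_bool _)%:Z.
  by rewrite -subr_eq0 -[RHS]subr_eq0; congr (_ == 0); ring.
rewrite exchange_big (bigD1 (0 : F)) //= big1 ?add0r; last first.
  by move=> x _; rewrite mul0r eq_sym (negPf c_neq0).
rewrite (eq_bigr (fun=> 1 : int)) => [|u u_neq0]; last first.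
  rewrite -[RHS](sum_eqz ((c / u - u) / 2)); apply: eq_bigr => x _.
  congr (nat_of_bool _)%:Z.
  by apply/eqP/eqP => [<-|->]; field; rewrite ?u_neq0 ?two_neq0.
by rewrite -[q]mulr1 -sum_constz [X in _ = X + _](bigD1 (0 : F)) //= addrAC subrr add0r.
Qed.

(** Completing the square: four times the quadratic is [(2 x + b)^2] minus the discriminant. *)
Lemma sum_monic_quadratic b c :
  \sum_x (x ^+ 2 + b * x + c == 0)%:Z = 1 + qc (b ^+ 2 - 4 * c).
Proof.
rewrite -sum_sqr_eq.
have inj : injective (fun x => 2 * x + b).
  by move=> x y /addIr; apply: mulfI.
rewrite [RHS](reindex_inj inj); apply: eq_bigr => x _ /=.
rewrite -[in RHS]subr_eq0.
rewrite (_ : _ - _ = 4 * (x ^+ 2 + b * x + c)); last by ring.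
by rewrite mulf_eq0 (negPf four_neq0).
Qed.

(* With t = 1/w the argument becomes (k (k - 4) - 4 k u w) / w^2. *)
Lemma sum_discriminant k u :
  \sum_t qc (k * t * (k * t - 4 * (u + t)))
    = ((u == 0)%:Z * q - 1) * qc (k * (k - 4)).
Proof.
have [->|k_neq0] := eqVneq k 0.
  by rewrite mul0r quadratic_char0 mulr0 big1 // => t _; rewrite !mul0r quadratic_char0.
rewrite (bigD1 (0 : F)) //= mulr0 mul0r quadratic_char0 add0r.
(* Only [w != 0] arises as an inverse, so the term at [w = 0] is subtracted from the full sum. *)
transitivity (\sum_w qc (k * (k - 4) + - 4 * k * u * w) - qc (k * (k - 4))).
  rewrite [in RHS](bigD1 (0 : F)) //= mulr0 addr0 [RHS]addrAC subrr add0r.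
  rewrite (reindex_inj invr_inj) /=; apply: eq_big => [w|w].
    by rewrite invr_eq0.
  move=> w_neq0; rewrite -[RHS](quadratic_char_sqrM w^-1) //.
  by congr (quadratic_char _); field; rewrite -invr_eq0.
have [->|u_neq0] := eqVneq u 0.
  under eq_bigr do rewrite mulr0 mul0r addr0.
  by rewrite sum_constz /=; ring.
rewrite sum_quadratic_char_affine ?mul0r //=; first by ring.
by rewrite !mulf_neq0 // oppr_eq0.
Qed.

End CharacterSums.

(** * The total number of solutions *)

Section Counts.
Context {F : finFieldType} (two_neq0 : 2 != 0 :> F).
Context (E : F) (E_neq0 : E != 0).
Local Notation qc := (@quadratic_char F).
Local Notation q := (#|F|%:Z).

Let four_neq0 : 4 != 0 :> F.
Proof. by rewrite (_ : 4 = 2 * 2 :> F) ?mulf_neq0 //; ring. Qed.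

(** With [X = E x y], one has [X (X - 4) = (X - 2)^2 - 4], and for [x != 0] the value [X - 2] runs
    over the field as [y] does. *)
Lemma sum_diagonal (x : F) :
  \sum_y qc (E * x * y * (E * x * y - 4)) = - (x != 0)%:Z.
Proof.
have [->|x_neq0] := eqVneq x 0.
  by rewrite big1 ?oppr0 // => y _; rewrite mulr0 !mul0r quadratic_char0.
have inj : injective (fun y => E * x * y - 2).
  by move=> y z /addIr; apply: mulfI; rewrite mulf_neq0.
rewrite -(sum_quadratic_char_sqrD two_neq0 (- 4)) ?oppr_eq0 //.
rewrite [RHS](reindex_inj inj); apply: eq_bigr => y _ /=.
by congr (quadratic_char _); ring.
Qed.

(** For [x != 0] the argument is [x^2 ((E x)^2 + 4 E)]. The full sum of the character of
    [(E x)^2 + 4 E] is [-1], and its term at [x = 0], equal to [qc E], is absent here. *)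
Lemma sum_antidiagonal :
  \sum_x qc (E * x * - x * (E * x * - x - 4)) = - 1 - qc E.
Proof.
have := sum_quadratic_char_sqrD two_neq0 (4 * E).
rewrite mulf_neq0 // => /(_ isT).
rewrite (reindex_inj (mulfI E_neq0)) (bigD1 (0 : F)) //= mulr0 expr0n /= add0r.
rewrite (_ : 4 * E = 2 ^+ 2 * E); last by ring.
rewrite quadratic_char_sqrM // => <-; rewrite addrAC subrr add0r.
rewrite (bigD1 (0 : F)) //= mulr0 !mul0r quadratic_char0 add0r.
apply: eq_bigr => x x_neq0; rewrite -[RHS](quadratic_char_sqrM two_neq0 x) //.
by congr (quadratic_char _); ring.
Qed.

Lemma card_solutions :
  #|{: solution (vieta_quartic E)}|%:Z = q ^+ 3 - 1 - qc E * q.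
Proof.
have -> : #|{: solution (vieta_quartic E)}|
    = #|[set x : {ffun 'I_4 -> F} | (vieta_quartic E).@[x] == 0]|.
  by rewrite card_sub; apply: eq_card => x; rewrite !inE.
rewrite card_quad.
transitivity (\sum_x \sum_y
    (q + ((x + y == 0)%:Z * q - 1) * qc (E * x * y * (E * x * y - 4)))).
  apply: eq_bigr => x _; apply: eq_bigr => y _.
  rewrite -(sum_discriminant two_neq0) -[X in X + _]mulr1 -sum_constz -big_split /=.
  apply: eq_bigr => t _.
  (* As a quadratic in [z], the equation has the discriminant treated by [sum_discriminant] with
     [k = E x y] and [u = x + y]. *)
  transitivity (1 + qc ((2 * (x + y + t) - E * x * y * t) ^+ 2
                        - 4 * (x + y + t) ^+ 2)).
    rewrite -(sum_monic_quadratic two_neq0); apply: eq_bigr => z _.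
    by rewrite meval_quad; congr (nat_of_bool (_ == 0))%:Z; ring.
  by congr (1 + quadratic_char _); ring.
(* For fixed [x], the factor [q] survives only at [y = -x], and the [-1] leaves minus the sum of
   [sum_diagonal]. *)
transitivity (\sum_x (q * q + q * qc (E * x * - x * (E * x * - x - 4))
    + (x != 0)%:Z)).
  apply: eq_bigr => x _; rewrite big_split /= sum_constz -addrA; congr (_ + _).
  under eq_bigr do rewrite mulrBl mul1r.
  rewrite sumrB sum_diagonal opprK; congr (_ + _).
  rewrite (bigD1 (- x)) //= subrr eqxx mul1r big1 ?addr0 // => y.
  by rewrite -addr_eq0 addrC => /negPf ->; rewrite !mul0r.
rewrite !big_split /= sum_constz -mulr_sumr sum_antidiagonal.
have -> : \sum_(x : F) (x != 0)%:Z = q - 1.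
  rewrite -[q]mulr1 -sum_constz -[X in _ - X](sum_eqz (0 : F)) -sumrB.
  by apply: eq_bigr => x _; case: eqP.
ring.
Qed.

(** * Counts by numbers of zero entries and of half-sum entries *)

Lemma sum_notin (s : seq F) : uniq s -> \sum_x (x \notin s)%:Z = q - (size s)%:Z.
Proof.
move=> s_uniq.
have <- : #|[set x | x \in s]| = size s by rewrite cardsE; exact/card_uniqP.
rewrite card_as_sum -[q]mulr1 -sum_constz -sumrB.
by apply: eq_bigr => x _; case: (_ \in _).
Qed.

Lemma sum_neq0 : \sum_(x : F) (x != 0)%:Z = q - 1.
Proof. by rewrite -(sum_notin [:: 0]) //; under [RHS]eq_bigr do rewrite inE. Qed.

(** The substitution of [2 x / E] for [x] turns the equation into [x^2 = - E]. *)
Lemma sum_Esqr_eqN4 : \sum_x (E * x ^+ 2 == - 4)%:Z = 1 + qc (- E).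
Proof.
have k_neq0 : 2 / E != 0 by rewrite mulf_neq0 ?invr_eq0.
rewrite -sum_sqr_eq // (reindex_inj (mulfI k_neq0)); apply: eq_bigr => x _ /=.
rewrite -subr_eq0 -[in RHS]subr_eq0; congr (nat_of_bool _)%:Z.
rewrite (_ : _ - _ = 4 / E * (x ^+ 2 - - E)); last by field.
by rewrite !mulf_eq0 invr_eq0 (negPf E_neq0) (negPf four_neq0).
Qed.

Lemma Esqr_eqN4_neq0 x : E * x ^+ 2 == - 4 -> x != 0.
Proof.
by apply: contraTneq => ->; rewrite expr0n mulr0 eq_sym oppr_eq0.
Qed.

(** With [a = 0], the entry [b = - (c + d)] is determined, and it is non-zero when [c != - d]; so
    [d] has [q - 1] choices and [c] has [q - 2]. *)
Lemma card_zeros1 :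
  #|[set x : {ffun 'I_4 -> F} | (\sum_i x i == 0) && (#|zeros x| == 1)%N]|%:Z
    = 4 * (q - 1) * (q - 2).
Proof.
rewrite card_zeros // bin1 -mulrA; congr (_ * _).
rewrite -sum_neq0 mulr_suml; apply: eq_bigr => d _.
have [->|d_neq0] := eqVneq d 0.
  by rewrite mul0r !big1 // => ? _; rewrite big1 // => ? _; rewrite big1 // => ? _;
    rewrite /= !andbF.
rewrite mul1r -[2]/(size [:: 0; - d])%:Z -sum_notin; last first.
  by rewrite /= andbT inE eq_sym oppr_eq0.
apply: eq_bigr => c _; rewrite !inE negb_or.
transitivity (\sum_b ((b == - (c + d)) && ((c != 0) && (c != - d)))%:Z).
  apply: eq_bigr => b _; rewrite -[RHS](sum_eq_andz (0 : F)
    (fun=> (b == - (c + d)) && ((c != 0) && (c != - d)))).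
  apply: eq_bigr => a _; rewrite /= eqb_id !eqbF_neg andbT.
  congr (nat_of_bool _)%:Z; rewrite andbCA; apply: andb_id2l => /eqP ->.
  rewrite add0r -addrA addr_eq0 /=; apply: andb_id2l => /eqP ->.
  rewrite oppr_eq0 addr_eq0; exact: andbC.
exact: (sum_eq_andz (- (c + d)) (fun=> (c != 0) && (c != - d))).
Qed.

Lemma card_zeros2 :
  #|[set x : {ffun 'I_4 -> F} | (\sum_i x i == 0) && (#|zeros x| == 2)%N]|%:Z
    = 6 * (q - 1).
Proof.
rewrite card_zeros //; congr (_ * _); rewrite -sum_neq0; apply: eq_bigr => d _.
rewrite -[RHS](sum_eq_andz (- d) (fun=> d != 0)); apply: eq_bigr => c _.
rewrite -[RHS](sum_eq_andz (0 : F) (fun=> (c == - d) && (d != 0))); apply: eq_bigr => b _.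
rewrite -[RHS](sum_eq_andz (0 : F) (fun=> (b == 0) && ((c == - d) && (d != 0)))); apply: eq_bigr => a _.
congr (nat_of_bool _)%:Z; rewrite /= !eqb_id !eqbF_neg.
rewrite andbCA; case: eqP => //= ->; rewrite andbCA; case: eqP => //= ->.
rewrite !add0r addr_eq0; case: eqP => //= ->; rewrite oppr_eq0; exact: andbb.
Qed.

Lemma card_zeros3 :
  #|[set x : {ffun 'I_4 -> F} | (\sum_i x i == 0) && (#|zeros x| == 3)%N]|%:Z
    = 0.
Proof.
rewrite card_zeros // !big1 ?mulr0 // => d _.
rewrite big1 // => c _; rewrite big1 // => b _; rewrite big1 // => a _.
rewrite /= !eqb_id !eqbF_neg; case: and5P => // [[/eqP s0 /eqP a0 /eqP b0 /eqP c0]].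
by move: s0; rewrite a0 b0 c0 !add0r => ->; rewrite eqxx.
Qed.

Lemma card_zeros4 :
  #|[set x : {ffun 'I_4 -> F} | (\sum_i x i == 0) && (#|zeros x| == 4)%N]|%:Z
    = 1.
Proof.
rewrite card_zeros // binn mul1r -(sum_eqz (0 : F)); apply: eq_bigr => d _.
rewrite -[RHS](sum_eq_andz (0 : F) (fun=> d == 0)); apply: eq_bigr => c _.
rewrite -[RHS](sum_eq_andz (0 : F) (fun=> (c == 0) && (d == 0))); apply: eq_bigr => b _.
rewrite -[RHS](sum_eq_andz (0 : F) (fun=> [&& b == 0, c == 0 & d == 0])); apply: eq_bigr => a _.
congr (nat_of_bool _)%:Z; rewrite /= !eqb_id.
rewrite andbCA; case: eqP => //= ->; rewrite andbCA; case: eqP => //= ->.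
rewrite andbCA; case: eqP => //= ->; rewrite !add0r; exact: andbb.
Qed.

(** Solves for [a], then [b], leaving conditions on [c] and [d] only. With [m = b + c + d] the sum
    is [2 m], and after cancelling [m] the equation is linear in [b]. The last conjunct keeps the
    denominator non-zero. *)
Lemma halves1_eq a b c d :
  [&& (a + b + c + d) ^+ 2 - E * (a * b * c * d) == 0,
      a + b + c + d != 0,
      (2 * a == a + b + c + d) == true,
      (2 * b == a + b + c + d) == false,
      (2 * c == a + b + c + d) == false
    & (2 * d == a + b + c + d) == false]
  = [&& a == b + c + d, b == 4 * (c + d) / (E * c * d - 4),
        (d != 0) && (E * d ^+ 2 != - 4), (c != 0) && (E * c ^+ 2 != - 4),
        c != - d & c != 4 / (E * d)].
Proof.
have -> : (2 * a == a + b + c + d) = (a == b + c + d).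
  by rewrite -subr_eq0 -[RHS]subr_eq0; congr (_ == 0); ring.
have [->|_] := eqVneq a (b + c + d); last by rewrite !andbF.
set m := b + c + d; have -> : m + b + c + d = 2 * m by rewrite /m; ring.
rewrite !(inj_eq (mulfI two_neq0)) mulf_eq0 (negPf two_neq0) /= !eqbF_neg.
have mE : (2 * m) ^+ 2 - E * (m * b * c * d) = m * (4 * m - E * b * c * d) by ring.
have bE : 4 * m - E * b * c * d = 4 * (c + d) - b * (E * c * d - 4).
  by rewrite /m; ring.
have bm : (b == m) = (c == - d).
  by rewrite -subr_eq0 -addr_eq0 -oppr_eq0; congr (_ == 0); rewrite /m; ring.
have cm : (c == m) = (b == - d).
  by rewrite -subr_eq0 -addr_eq0 -oppr_eq0; congr (_ == 0); rewrite /m; ring.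
have dm : (d == m) = (b == - c).
  by rewrite -subr_eq0 -addr_eq0 -oppr_eq0; congr (_ == 0); rewrite /m; ring.
rewrite mE mulf_eq0 bm cm dm.
rewrite -!addr_eq0.
(* Once [4 m = E b c d], these identities turn [b != - d] and [b != - c] into [E d^2 != - 4] and
   [E c^2 != - 4]. *)
have idd : (c + d) * (E * d * (b + d))
    = m * (E * d ^+ 2 + 4) - (4 * m - E * b * c * d) by rewrite /m; ring.
have idc : (c + d) * (E * c * (b + c))
    = m * (E * c ^+ 2 + 4) - (4 * m - E * b * c * d) by rewrite /m; ring.
have cdE : d != 0 -> (c == 4 / (E * d)) = (E * c * d - 4 == 0).
  move=> d_neq0; rewrite -(inj_eq (mulIf (mulf_neq0 E_neq0 d_neq0))).
  by rewrite divfK ?mulf_neq0 // subr_eq0 mulrCA mulrA.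
apply/idP/idP.
  case/and5P=> /orP[->//|/eqP e0] m_neq0 cd bd bc.
  have : E * b * c * d != 0.
    by move/eqP: e0; rewrite subr_eq0 => /eqP <-; rewrite mulf_neq0.
  rewrite !mulf_eq0 (negPf E_neq0) /= !negb_or => /andP[/andP[_ c_neq0] d_neq0].
  have bk : b * (E * c * d - 4) = 4 * (c + d).
    by apply/eqP; rewrite eq_sym -subr_eq0 -bE e0.
  have k_neq0 : E * c * d - 4 != 0.
    have : 4 * (c + d) != 0 by rewrite mulf_neq0.
    by rewrite -bk mulf_eq0 negb_or => /andP[].
  rewrite cdE // k_neq0 cd d_neq0 c_neq0 -bk mulfK // eqxx /= andbT.
  move: idd idc; rewrite e0 !subr0 => idd idc; apply/andP; split.
    apply: contraTneq bd => h0; move/eqP: idd.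
    by rewrite h0 mulr0 !mulf_eq0 (negPf cd) (negPf E_neq0) (negPf d_neq0) negbK.
  apply: contraTneq bc => h0; move/eqP: idc.
  by rewrite h0 mulr0 !mulf_eq0 (negPf cd) (negPf E_neq0) (negPf c_neq0) negbK.
case/and5P=> /eqP bg /andP[d_neq0 hd] /andP[c_neq0 hc] cd.
rewrite cdE // => k_neq0.
have e0 : 4 * m - E * b * c * d = 0 by rewrite bE bg divfK // subrr.
have m_neq0 : m != 0.
  (* If [m = 0] then [b = 0]; as [c + d != 0], the formula for [b] vanishes only when its
     denominator does. *)
  apply: contraTneq k_neq0 => m0.
  have : E * b * c * d == 0 by move/eqP: e0; rewrite m0 mulr0 sub0r oppr_eq0.
  rewrite !mulf_eq0 (negPf E_neq0) (negPf c_neq0) (negPf d_neq0) !orbF /=.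
  by rewrite bg !mulf_eq0 (negPf four_neq0) (negPf cd) invr_eq0 negbK.
rewrite e0 eqxx orbT m_neq0 cd /=; move: idd idc; rewrite e0 !subr0 => idd idc.
apply/andP; split.
  have : m * (E * d ^+ 2 + 4) != 0 by rewrite mulf_neq0.
  by rewrite -idd !mulf_eq0 !negb_or => /andP[_ /andP[_]].
have : m * (E * c ^+ 2 + 4) != 0 by rewrite mulf_neq0.
by rewrite -idc !mulf_eq0 !negb_or => /andP[_ /andP[_]].
Qed.

(** There are [q - 1] non-zero [d], less the [1 + qc (- E)] roots of [E d^2 = - 4]. For each
    remaining [d], the entry [c] avoids those roots and three further values. *)
Lemma card_halves1 :
  #|[set x : {ffun 'I_4 -> F} |
       [&& (vieta_quartic E).@[x] == 0 & \sum_i x i != 0]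
       && (#|halves x| == 1)%N]|%:Z
    = 4 * (q - 2 - qc (- E)) * (q - 4 - qc (- E)).
Proof.
rewrite card_halves // bin1 -mulrA; congr (_ * _).
pose A d := (d != 0) && (E * d ^+ 2 != - 4).
pose B c d := [&& A c, c != - d & c != 4 / (E * d)].
transitivity (\sum_d (A d)%:Z * (q - 4 - qc (- E))).
  apply: eq_bigr => d _; transitivity (\sum_c (A d && B c d)%:Z).
    apply: eq_bigr => c _.
    rewrite -(sum_eq_andz (4 * (c + d) / (E * c * d - 4)) (fun=> A d && B c d)).
    apply: eq_bigr => b _.
    rewrite -[RHS](sum_eq_andz (b + c + d)
      (fun=> (b == 4 * (c + d) / (E * c * d - 4)) && (A d && B c d))).
    apply: eq_bigr => a _; congr (nat_of_bool _)%:Z; exact: halves1_eq.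
  have [Ad|_] := boolP (A d); last by rewrite big1 ?mul0r.
  have [d_neq0 Ed] := andP Ad.
  transitivity (\sum_c ((c \notin [:: 0; - d; 4 / (E * d)])%:Z
                        - (E * c ^+ 2 == - 4)%:Z)).
    apply: eq_bigr => c _; rewrite /B /A !inE !negb_or.
    (* Roots are not among the three values: at [c = - d] and at [c = 4 / (E d)], [E c^2 + 4] is a
       non-zero multiple of [E d^2 + 4]. *)
    have [Ec|_] := boolP (E * c ^+ 2 == - 4); last by rewrite subr0 andbT.
    rewrite (Esqr_eqN4_neq0 _ Ec) andbF /=.
    have -> : c != - d.
      by apply: contraNneq Ed => cd; rewrite -(eqP Ec) cd sqrrN.
    have -> // : c != 4 / (E * d).
      apply: contraNneq Ed => cd; move: Ec; rewrite cd -!addr_eq0.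
      rewrite (_ : _ + 4 = 4 / (E * d ^+ 2) * (E * d ^+ 2 + 4)).
        rewrite mulf_eq0 (negPf (_ : 4 / _ != 0)) //.
        by rewrite mulf_neq0 ?invr_eq0 ?mulf_neq0 ?sqrf_eq0.
      by field; rewrite E_neq0 d_neq0.
  rewrite sumrB sum_notin ?sum_Esqr_eqN4 /=; first by ring.
  have Ed_neq0 : 4 / (E * d) != 0 by rewrite mulf_neq0 ?invr_eq0 ?mulf_neq0.
  rewrite /= !inE !(eq_sym 0) negb_or oppr_eq0 d_neq0 Ed_neq0 /= andbT.
  apply: contraNneq Ed => dE; rewrite -subr_eq0 opprK.
  rewrite (_ : _ + 4 = 4 - - d * (E * d)); last by ring.
  by rewrite dE divfK ?mulf_neq0 // subrr.
rewrite -mulr_suml; congr (_ * _).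
transitivity (\sum_d ((d != 0)%:Z - (E * d ^+ 2 == - 4)%:Z)).
  apply: eq_bigr => d _; rewrite /A; case: (boolP (E * _ == _)) => [/Esqr_eqN4_neq0 ->|].
    by [].
  by rewrite andbT subr0.
rewrite sumrB sum_neq0 sum_Esqr_eqN4; ring.
Qed.

(** The conditions give [a = b] and [c = - d], so the equation is [b^2 (E d^2 + 4) = 0]. Each root
    [d] leaves every [b] outside [0], [d], [- d]. *)
Lemma card_halves2 :
  #|[set x : {ffun 'I_4 -> F} |
       [&& (vieta_quartic E).@[x] == 0 & \sum_i x i != 0]
       && (#|halves x| == 2)%N]|%:Z
    = 6 * (1 + qc (- E)) * (q - 3).
Proof.
rewrite card_halves // -mulrA; congr (_ * _).
rewrite -sum_Esqr_eqN4 mulr_suml; apply: eq_bigr => d _.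
pose B b := (E * d ^+ 2 == - 4) && (b \notin [:: 0; d; - d]).
transitivity (\sum_b (B b)%:Z); last first.
  rewrite /B; have [Ed|_] := boolP (E * d ^+ 2 == - 4); last first.
    by rewrite mul0r big1.
  have d_neq0 := Esqr_eqN4_neq0 _ Ed.
  rewrite mul1r sum_notin //= !inE !(eq_sym 0) oppr_eq0 negb_or d_neq0 /= andbT.
  by rewrite -subr_eq0 opprK -mulr2n -mulr_natl mulf_neq0.
(* Here [b] is free and [c] is determined, so [b] must be summed outside [c]. *)
rewrite exchange_big; apply: eq_bigr => b _ /=.
rewrite -(sum_eq_andz (- d) (fun=> B b)); apply: eq_bigr => c _.
rewrite -[RHS](sum_eq_andz b (fun=> (c == - d) && B b)); apply: eq_bigr => a _.
congr (nat_of_bool _)%:Z; rewrite /= !eqbF_neg !eqb_id.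
have [->|ab] := eqVneq a b; last first.
  apply: contra_neqF ab => /and5P[_ _ /eqP ha /eqP hb _].
  by apply: (mulfI two_neq0); rewrite ha hb.
have [->|cd] := eqVneq c (- d); last first.
  rewrite (_ : (2 * b == _) = false) ?andbF //; apply: contra_neqF cd => /eqP hb.
  by apply/eqP; rewrite -addr_eq0; apply/eqP; apply: (addrI (2 * b)); rewrite addr0 {2}hb; ring.
have -> : b + b + - d + d = 2 * b by ring.
rewrite eqxx !(inj_eq (mulfI two_neq0)) mulf_eq0 (negPf two_neq0) /=.
have -> : (2 * b) ^+ 2 - E * (b * b * - d * d) = b ^+ 2 * (E * d ^+ 2 + 4) by ring.
rewrite mulf_eq0 sqrf_eq0 addr_eq0 /B !inE !negb_or.
have [->|b_neq0] //= := eqVneq b 0; first by rewrite andbF.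
by rewrite (eq_sym _ b) (eq_sym d) [in RHS](andbC (b != d)).
Qed.

(** Now [a = b = c = - d], and the equation is [d^2 (E d^2 + 4) = 0] with [d != 0]. *)
Lemma card_halves3 :
  #|[set x : {ffun 'I_4 -> F} |
       [&& (vieta_quartic E).@[x] == 0 & \sum_i x i != 0]
       && (#|halves x| == 3)%N]|%:Z
    = 4 * (1 + qc (- E)).
Proof.
rewrite card_halves //; congr (_ * _).
rewrite -sum_Esqr_eqN4; apply: eq_bigr => d _.
rewrite -(sum_eq_andz (- d) (fun=> E * d ^+ 2 == - 4)); apply: eq_bigr => c _.
rewrite -[RHS](sum_eq_andz c (fun=> (c == - d) && (E * d ^+ 2 == - 4))).
apply: eq_bigr => b _.
rewrite -[RHS](sum_eq_andz b
  (fun=> [&& b == c, c == - d & E * d ^+ 2 == - 4])).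
apply: eq_bigr => a _; congr (nat_of_bool _)%:Z; rewrite /= !eqbF_neg !eqb_id.
have [->|ab] := eqVneq a b; last first.
  apply: contra_neqF ab => /and5P[_ _ /eqP ha /eqP hb _].
  by apply: (mulfI two_neq0); rewrite ha hb.
have [->|bc] := eqVneq b c; last first.
  apply: contra_neqF bc => /and5P[_ _ _ /eqP hb /andP[/eqP hc _]].
  by apply: (mulfI two_neq0); rewrite hb hc.
have [->|cd] := eqVneq c (- d); last first.
  rewrite (_ : (2 * c == _) = false) ?andbF //; apply: contra_neqF cd => /eqP hc.
  by apply/eqP; rewrite -addr_eq0; apply/eqP; apply: (addrI (2 * c)); rewrite addr0 {2}hc; ring.
have -> : - d + - d + - d + d = 2 * - d by ring.
rewrite eqxx !(inj_eq (mulfI two_neq0)) mulf_eq0 (negPf two_neq0) oppr_eq0 /=.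
have -> : (2 * - d) ^+ 2 - E * (- d * - d * - d * d) = d ^+ 2 * (E * d ^+ 2 + 4).
  by ring.
have -> : (d == - d) = (d == 0).
  by rewrite -addr_eq0 -mulr2n -mulr_natl mulf_eq0 (negPf two_neq0).
rewrite mulf_eq0 sqrf_eq0 addr_eq0.
have [->|d_neq0] /= := eqVneq d 0; last by rewrite andbT.
by rewrite expr0n mulr0 eq_sym oppr_eq0 (negPf four_neq0).
Qed.

(** Adding the four equations gives [2 S = 4 S], contradicting [S != 0]. *)
Lemma card_halves4 :
  #|[set x : {ffun 'I_4 -> F} |
       [&& (vieta_quartic E).@[x] == 0 & \sum_i x i != 0]
       && (#|halves x| == 4)%N]|%:Z
    = 0.
Proof.
rewrite card_halves // big1 ?mulr0 // => d _; rewrite big1 // => c _.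
rewrite big1 // => b _; rewrite big1 // => a _; rewrite /= !eqb_id.
case: and5P => // [[_ s_neq0 /eqP ha /eqP hb /andP[/eqP hc /eqP hd]]].
set S := a + b + c + d in s_neq0 ha hb hc hd.
have SE : 2 * S = S + S + S + S.
  by transitivity (2 * a + 2 * b + 2 * c + 2 * d);
    [rewrite /S; ring | rewrite ha hb hc hd].
case/negP: s_neq0; rewrite -(mulrI_eq0 _ (mulfI two_neq0)); apply/eqP.
by apply: (addrI (2 * S)); rewrite addr0 [RHS]SE; ring.
Qed.

(** * Assembly of the degree counts *)

Lemma num_degree3 : (num_degree (vieta_quartic E) 3)%:Z
  = 4 * ((q - 3) ^+ 2 - 2 * qc (- E) * (q - 3)).
Proof.
rewrite num_degree_split // PoszD card_halves1.
rewrite [#|_|](_ : _ = 0%N); last first.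
  by apply: eq_card0 => x; rewrite inE andbF.
have : qc (- E) ^+ 2 = 1.
  by rewrite /quadratic_char oppr_eq0 (negPf E_neq0); case: ifP.
move: (qc _) => e ee; rewrite addr0.
(* The product from [card_halves1] is [4 ((q - 3 - e)^2 - 1)], and [e^2 = 1]. *)
transitivity (4 * ((q - 3) ^+ 2 - 2 * e * (q - 3)) + 4 * (e ^+ 2 - 1)).
  by ring.
by rewrite ee subrr mulr0 addr0.
Qed.

Lemma num_degree2 : (num_degree (vieta_quartic E) 2)%:Z
  = 6 * (1 + qc (- E)) * (q - 3).
Proof.
rewrite num_degree_split // PoszD card_halves2.
rewrite [#|_|](_ : _ = 0%N) ?addr0 //.
by apply: eq_card0 => x; rewrite inE andbF.
Qed.

Lemma num_degree1 : (num_degree (vieta_quartic E) 1)%:Z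
  = 4 * (q ^+ 2 - 3 * q + 3 + qc (- E)).
Proof.
rewrite num_degree_split // PoszD card_halves3 /=.
under eq_finset do rewrite inE.
by rewrite card_zeros1; ring.
Qed.

Lemma num_degree0 : (num_degree (vieta_quartic E) 0)%:Z = 6 * q - 5.
Proof.
rewrite num_degree_split // PoszD card_halves4 card_as_sum /=.
(* The summands come from two, three and four zero entries. *)
transitivity (6 * (q - 1) + 0 + 1); last by ring.
rewrite add0r -[X in _ = X + _ + _]card_zeros2 -[X in _ = _ + X + _]card_zeros3.
rewrite -[X in _ = _ + X]card_zeros4 !card_as_sum -!big_split /=.
apply: eq_bigr => x _; rewrite !inE; case: (_ == 0) => //=.
by case: #|zeros x| => [|[|[|[|[|]]]]].
Qed.

End Counts.

(** * Specialisation to the prime field *)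

Theorem theorem15p2 (p : nat) (p_prime : prime p) (p_ge5 : (5 <= p)%N)
    (E : 'F_p) (E_neq0 : E != 0) :
  [/\ (#|{: solution (vieta_quartic E)}|%:Z
         = p%:Z ^+ 3 - 1 - quadratic_char E * p%:Z :> int),
      ((num_degree (vieta_quartic E) 3)%:Z
         = 4 * ((p%:Z - 3) ^+ 2 - 2 * quadratic_char (- E) * (p%:Z - 3)) :> int),
      ((num_degree (vieta_quartic E) 2)%:Z
         = 6 * (1 + quadratic_char (- E)) * (p%:Z - 3) :> int),
      ((num_degree (vieta_quartic E) 1)%:Z
         = 4 * (p%:Z ^+ 2 - 3 * p%:Z + 3 + quadratic_char (- E)) :> int)
    & ((num_degree (vieta_quartic E) 0)%:Z = 6 * p%:Z - 5 :> int)].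
Proof.
have two_neq0 : 2 != 0 :> 'F_p.
  (* If [2] vanished, [p] would divide 2, against [p >= 5]. *)
  rewrite -(dvdn_pcharf (pchar_Fp p_prime)); apply/negP => /dvdn_leq -/(_ isT).
  by rewrite leqNgt (leq_trans _ p_ge5).
have -> : p%:Z = #|{: 'F_p}|%:Z by rewrite card_Fp.
split.
- exact: card_solutions.
- exact: num_degree3.
- exact: num_degree2.
- exact: num_degree1.
- exact: num_degree0.
Qed.
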